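(* Let $q$ be an odd prime power and let $K$ be a Kakeya set in $\pi_q=PG(2,q)$. Then \[ |K|\ge \frac{q(q+1)}{2}+\frac{q-1}{2}. \] Equality holds if and only if $K$ is of the form $K(\mathcal O,\ell,\ell_A)$ for some dual oval $\mathcal O$ in $\pi_q$, some line $\ell\in\mathcal O$, and some line $\ell_A\neq \ell$ through the unique point $A$ of $\ell$ that lies on no line of $\mathcal O$ other than $\ell$.
   Context: $\pi_q=PG(2,q)$ is the projective plane over the finite field $GF(q)$; lines are identified with their sets of points. Kakeya set: let $\ell$ be a line of $\pi_q$ and, for every point $P\in\ell$, let $\ell_P$ be a line through $P$ other than $\ell$. The set $K=\bigl(\bigcup_{P\in\ell}\ell_P\bigr)\setminus\ell$ is called a Kakeya set. A Kakeya set in $\pi_q$ is any set of points arising in this way. Dual oval: a set $\mathcal O$ of $q+1$ lines of $\pi_q$, no three of which are concurrent. The sets $K(\mathcal O,\ell,\ell_A)$ ($q$ odd): let $\mathcal O$ be a dual oval and $\ell\in\mathcal O$. Every point $P$ of $\ell$ except exactly one lies on a unique second line $\ell_P\in\mathcal O$, $\ell_P\ne\ell$. Let $A$ be the exceptional point of $\ell$ and let $\ell_A$ be any line through $A$ different from $\ell$. Then $K(\mathcal O,\ell,\ell_A)=\bigl(\bigcup_{P\in\ell}\ell_P\bigr)\setminus\ell$. *)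

(* Defs.v *)
From HB Require Import structures.
From mathcomp Require Import all_boot all_order all_algebra.

Set Implicit Arguments.
Unset Strict Implicit.
Unset Printing Implicit Defensive.

Import GRing.Theory.

Section VspaceFinite.
(* Makes the encoding of a subspace by its canonical matrix available as a
   subtype, from which finiteness is inherited. *)
Import VectorInternalTheory.
Variables (F : finFieldType) (vT : vectType F).
HB.instance Definition _ := [Countable of {vspace vT} by <:].
HB.instance Definition _ := [Finite of {vspace vT} by <:].
End VspaceFinite.

(* PG(2, q): the points are the one-dimensional subspaces of F^3, q = #|F|. *)
Definition point (F : finFieldType) : finType :=
  {U : {vspace 'rV[F]_3} | \dim U == 1}.

Section ProjectivePlane.
Variable F : finFieldType.
Implicit Types (P A : point F) (l m lA K : {set point F}) (O : {set {set point F}}).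

(* A line is identified with the set of points contained in a plane of F^3. *)
Definition line_of (W : {vspace 'rV[F]_3}) : {set point F} :=
  [set P | (val P <= W)%VS].

Definition lines : {set {set point F}} :=
  [set line_of W | W : {vspace 'rV[F]_3} & \dim W == 2].

Definition kakeya K : Prop :=
  exists2 l, l \in lines &
  exists2 lP : point F -> {set point F},
    forall P, P \in l -> [/\ lP P \in lines, P \in lP P & lP P != l] &
    K = (\bigcup_(P in l) lP P) :\: l.

Definition concurrent l1 l2 l3 : Prop :=
  exists P, [/\ P \in l1, P \in l2 & P \in l3].

Definition dual_oval O : Prop :=
  [/\ O \subset lines,
      #|O| = #|F|.+1 &
      forall l1 l2 l3, l1 \in O -> l2 \in O -> l3 \in O ->
        l1 != l2 -> l1 != l3 -> l2 != l3 -> ~ concurrent l1 l2 l3].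

Definition exceptional_points O l : {set point F} :=
  [set P in l | [forall m in O, (P \in m) ==> (m == l)]].

(* For a dual oval O and l \in O, at most one m satisfies the pick condition
   at a given P, and none does exactly when P is exceptional: there the line
   is the chosen lA. *)
Definition oval_line O l lA P : {set point F} :=
  odflt lA [pick m in O | (m != l) && (P \in m)].

Definition oval_kakeya O l lA : {set point F} :=
  (\bigcup_(P in l) oval_line O l lA P) :\: l.

End ProjectivePlane.

(* Main.v *)
Require Import Defs.
From mathcomp Require Import all_boot all_order all_algebra all_field.
From mathcomp Require Import ring zify.
Set Implicit Arguments.
Unset Strict Implicit.
Unset Printing Implicit Defensive.
Import GRing.Theory.

(** Let l be the line at infinity and B one of its points. In suitable affine
coordinates (m, b) the line chosen at B is m = 0, and the lines chosen at the
other points of l, having all the other directions, are b = f x - x m with x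
running over F. The Kakeya set is thus encoded by a map f : F -> F
([exists_chart]), and [mult p] is the number of the q + 1 lines through p.

Counting. Any two of the lines meet in exactly one affine point, so the sums of
mult p and of mult p (mult p - 1) are both q (q + 1). Comparing point by point,
4 |K| is at least 2 q (q + 1) plus the number of points of odd multiplicity,
with equality exactly when no point has multiplicity above 3 ([covered_count]).
The bound follows once at least 2 q - 2 points are known to be odd.

Odd points. An affine line that is not one of the q + 1 lines meets exactly q
of them, and q is odd: it contains a point of odd multiplicity. If one of the
q + 1 lines has no odd point, all its points have multiplicity 2. Two such lines
cannot coexist: if one is m = 0, the product of the abscissae at which the other
one is crossed would be both 1 and -1 ([even_infty_unique]). So the odd points, with at most
one further point, meet all lines of the affine plane, and such a set has at
least 2 q - 1 points ([affine_blocking_set], the theorem of Jamison and of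
Brouwer and Schrijver).

Equality. If |K| is minimal then all multiplicities are at most 3, there are
2 q - 2 odd points, and one line carries no odd point; taking it as m = 0 makes
f a permutation. Each other line has as many simple as triple points, and at
least one; there are (q - 1) / 2 triple points in all, fewer than there are
ordinary lines, the lines with a single triple point. Multiplying over all
intersections with a given line, as in Segre's lemma of tangents, gives for
ordinary lines x, x' with triple points at abscissae s, s':
- the simple point of x has abscissa - s ([ordinary_abscissae]);
- s s' (x' - x)^2 = (f x' - f x)^2 ([pair_abscissae]);
- a third line r through a triple point common to x and x' satisfies
  2 r = x + x' ([pair_midpoint]).
By the pigeonhole principle two ordinary lines share their triple point. Let c
be the third line through it: subtracting two instances of the quadratic
relation shows that the triple point of every ordinary line lies on c, and
then, by counting, that c contains all triple points ([triple_concurrent]).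
Without c no three of the lines are concurrent, so together with l they form a
dual oval.

Conversely, if the lines other than m = 0 come from a dual oval, at most two of
them pass through each point; each of them has exactly one point on no other,
and a parity count places exactly one of these points on each line
m = constant, which determines |K| ([card_covered_le2]). *)

Local Open Scope ring_scope.

(** * Finite sums and sets *)

Lemma sum_bool (T : finType) (P : pred T) :
  (\sum_x nat_of_bool (P x) = #|[set x | P x]|)%N.
Proof. by rewrite -sum1dep_card [RHS]big_mkcond; apply: eq_bigr => x _; case: (P x). Qed.

Lemma odd_sum_ex (T : finType) (g : T -> nat) :
  odd (\sum_i g i) -> exists i, odd (g i).
Proof.
move=> o; apply/existsP; apply: contraLR o; rewrite negb_exists => /forallP ev.
by apply: (big_ind (fun n => ~~ odd n)) => // m n; rewrite oddD => /negPf-> /negPf->.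
Qed.

(** Even positive numbers are at least 2, so an average of 2 forces equality. *)
Lemma sum_even_pos (T : finType) (g : T -> nat) :
    (forall i, 0 < g i)%N -> (forall i, ~~ odd (g i)) ->
  (\sum_i g i = #|T| * 2)%N -> forall i, g i = 2%N.
Proof.
move=> pos ev sg i.
have ge2 j : (j \in predT) -> (2 <= g j ?= iff (2 == g j))%N.
  by move=> _; split=> //; case: (g j) (pos j) (ev j) => [|[]].
have [_] := leqif_sum ge2.
by rewrite sg sum_nat_const eqxx => /esym/forallP/(_ i)/eqP.
Qed.

Lemma card_bigcup_le (I T : finType) (S : {set I}) (B : I -> {set T}) :
  (#|\bigcup_(i in S) B i| <= \sum_(i in S) #|B i|)%N.
Proof.
apply: (big_ind2 (fun (X : {set T}) n => #|X| <= n)%N) => [|X m Y n Xm Yn|//].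
  by rewrite cards0.
by apply: leq_trans (leq_card_setU _ _) _; apply: leq_add.
Qed.

Lemma uniq4 (T : eqType) (x a b c : T) :
  a != x -> b != x -> c != x -> a != b -> a != c -> b != c -> uniq [:: x; a; b; c].
Proof.
by move=> ax bx cx ab ac bc; rewrite /= !inE !negb_or !(eq_sym x) ax bx cx ab ac bc.
Qed.

(** * Finite fields and affine blocking sets *)

Section FiniteField.
Variable F : finFieldType.

(** Wilson's theorem for F: constant terms in the factorisation of X^(q-1) - 1. *)
Lemma prod_nonzero : \prod_(x : F | x != 0) x = -1.
Proof.
have XnX : 'X^(#|F|.-1) - 1 = \prod_(x : F | x != 0) ('X - x%:P) :> {poly F}.
  apply: (mulfI (negbT (polyX_eq0 F))).
  rewrite mulrBr mulr1 -exprS prednK; last by rewrite (cardD1 0).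
  by rewrite finField_genPoly (bigD1 0) //= subr0.
have q1 : (0 < #|F|.-1)%N by rewrite -ltnS prednK ?finNzRing_gt1 // (cardD1 0).
move: (congr1 (horner^~ 0) XnX); rewrite horner_prod !hornerE expr0n eqn0Ngt q1 sub0r.
move=> ->; rewrite (reindex_inj (@oppr_inj F)) /=.
by apply: eq_big => [x|x _]; rewrite ?oppr_eq0 // !hornerE.
Qed.

(** For i > 0 the nonzero elements cannot all be roots of X^i - 1, as i < q - 1;
if c is not one, substituting c u for u multiplies the sum by c^i, which is not 1. *)
Lemma sum_expr_eq0 i : (i < #|F|.-1)%N -> \sum_(u : F) u ^+ i = 0.
Proof.
case: i => [_|i hi].
  under eq_bigr do rewrite expr0.
  apply: (addrI (\sum_(u : F) u)); rewrite addr0 -big_split /=.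
  by rewrite [RHS](reindex_inj (addIr 1)).
have [c c0 ci] : exists2 c : F, c != 0 & c ^+ i.+1 != 1.
  apply/exists_inP; apply: contraT; rewrite negb_exists_in => /forall_inP ci.
  have p0 : 'X^(i.+1) - 1%:P != 0 :> {poly F}.
    by rewrite -size_poly_eq0 size_XnsubC.
  have := max_poly_roots (rs := enum [pred c : F | c != 0]) p0.
  rewrite size_XnsubC // enum_uniq -cardE => /(_ _ isT).
  have -> : #|[pred c : F | c != 0]| = #|F|.-1.
    by rewrite -(cardC1 0); apply: eq_card => c; rewrite !inE.
  rewrite ltnS leqNgt hi => roots.
  suff /roots : all (root ('X^(i.+1) - 1%:P)) (enum [pred c : F | c != 0]) by [].
  apply/allP => c; rewrite mem_enum => /ci /negPn/eqP ci1.
  by rewrite rootE !hornerE ci1 subrr.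
apply/eqP; rewrite -(mulrI_eq0 _ (mulfI (_ : c ^+ i.+1 - 1 != 0))) ?subr_eq0 //.
rewrite mulrBl mul1r mulr_sumr subr_eq0; apply/eqP.
rewrite [RHS](reindex_inj (mulfI c0)).
by apply: eq_bigr => u _; rewrite exprMn.
Qed.

(** Every monomial of the product has degree below q - 1 in u or in v, so its sum
over F x F vanishes. The induction carries a monomial in front of the product,
which absorbs the factors one at a time. *)
Lemma sum_affine_prod_eq0 (s : seq (F * F * F)) :
  (size s < 2 * #|F|.-1)%N ->
  \sum_(u : F) \sum_(v : F) \prod_(a <- s) (u * a.1.1 + v * a.1.2 + a.2) = 0.
Proof.
suff H i j : (i + j + size s < 2 * #|F|.-1)%N ->
    \sum_(u : F) \sum_(v : F)
      u ^+ i * v ^+ j * \prod_(a <- s) (u * a.1.1 + v * a.1.2 + a.2) = 0.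
  move=> /(H 0 0)%N H0; rewrite -[RHS]H0; apply: eq_bigr => u _; apply: eq_bigr => v _.
  by rewrite !mul1r.
elim: s i j => [|a s IH] i j /= hs.
  have -> : \sum_(u : F) \sum_(v : F)
      u ^+ i * v ^+ j * \prod_(a <- [::]) (u * a.1.1 + v * a.1.2 + a.2)
    = (\sum_(u : F) u ^+ i) * (\sum_(v : F) v ^+ j).
    rewrite mulr_suml; apply: eq_bigr => u _; rewrite mulr_sumr.
    by apply: eq_bigr => v _; rewrite big_nil mulr1.
  case: (ltnP i #|F|.-1) => hi; first by rewrite sum_expr_eq0 // mul0r.
  rewrite (sum_expr_eq0 (i := j)) ?mulr0 //; move: hs hi; set q := #|F|.-1; lia.
transitivity
  (a.1.1 * (\sum_(u : F) \sum_(v : F)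
      u ^+ i.+1 * v ^+ j * \prod_(a <- s) (u * a.1.1 + v * a.1.2 + a.2))
 + a.1.2 * (\sum_(u : F) \sum_(v : F)
      u ^+ i * v ^+ j.+1 * \prod_(a <- s) (u * a.1.1 + v * a.1.2 + a.2))
 + a.2 * (\sum_(u : F) \sum_(v : F)
      u ^+ i * v ^+ j * \prod_(a <- s) (u * a.1.1 + v * a.1.2 + a.2))); last first.
  by rewrite !IH ?mulr0 ?addr0 //; move: hs; set q := #|F|.-1; lia.
rewrite !mulr_sumr -!big_split; apply: eq_bigr => u _ /=.
rewrite !mulr_sumr -!big_split; apply: eq_bigr => v _ /=.
by rewrite big_cons !exprS; ring.
Qed.

(** The theorem of Jamison and of Brouwer and Schrijver. With the origin at a
point o of S, a line missing o has an equation u X + v Y = 1 with (u, v) nonzero,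
and it meets S; so the product over S minus o of the forms u X + v Y - 1 vanishes
at all (u, v) except at (0, 0). Its sum over F x F is then nonzero, which bounds
the number of factors from below. *)
Lemma affine_blocking_set (S : {set F * F}) :
  (forall a b c : F, (a != 0) || (b != 0) ->
     exists2 p, p \in S & a * p.1 + b * p.2 = c) ->
  (2 * #|F| - 1 <= #|S|)%N.
Proof.
move=> blk; rewrite leqNgt; apply/negP => hS.
have [o oS _] : exists2 p : F * F, p \in S & 1 * p.1 + 0 * p.2 = 0 :> F.
  by apply: blk; rewrite oner_neq0.
pose s := [seq ((p.1 - o.1, p.2 - o.2), -1 : F) | p <- enum (S :\ o)].
have hs : (size s < 2 * #|F|.-1)%N.
  rewrite size_map -cardE; move: (cardsD1 o S) hS; rewrite oS.
  by set q := #|F|; set k := #|S|; set k' := #|S :\ o|; lia.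
have vanish u v : (u != 0) || (v != 0) ->
    \prod_(a <- s) (u * a.1.1 + v * a.1.2 + a.2) = 0.
  move=> uv; have [p pS e] := blk u v (1 + u * o.1 + v * o.2) uv.
  apply/eqP; rewrite prodf_seq_eq0; apply/hasP.
  exists ((p.1 - o.1, p.2 - o.2), -1).
    apply: (map_f (fun p : F * F => ((p.1 - o.1, p.2 - o.2), -1))).
    rewrite mem_enum !inE pS andbT; apply/eqP => po.
    by move: e; rewrite po -addrA -[LHS]add0r => /addIr /esym/eqP; rewrite oner_eq0.
  by apply/eqP => /=; rewrite -[RHS](subrr (u * p.1 + v * p.2)) {2}e; ring.
have := sum_affine_prod_eq0 hs.
rewrite (bigD1 0) //= (bigD1 0) //= [X in _ + X + _]big1 => [|v v0]; last first.
  by rewrite vanish // v0 orbT.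
rewrite [X in _ + X]big1 => [|u u0]; last first.
  by apply: big1 => v _; rewrite vanish // u0.
rewrite !addr0 big_map => /eqP; rewrite prodf_seq_eq0 => /hasP[p _] /=.
by rewrite !mul0r !add0r oppr_eq0 oner_eq0.
Qed.

(** Both products, of y - x' and of y - x, run over all nonzero elements except
x - x' and x' - x respectively, and these two are opposite. *)
Lemma prod_ratio (x x' : F) : x' != x ->
  \prod_(y | (y != x) && (y != x')) ((y - x') / (y - x)) = -1.
Proof.
move=> xx'; have P (z z' : F) : z' != z ->
    (z' - z) * \prod_(y | (y != z) && (y != z')) (y - z) = -1.
  move=> zz'; rewrite -prod_nonzero [RHS](reindex_inj (h := fun y => y - z)) /=; last first.
    exact: addIr.
  rewrite [RHS](bigD1 z') /= ?subr_eq0 //; congr (_ * _).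
  by apply: eq_bigl => y; rewrite subr_eq0.
rewrite big_split /= prodfV.
have /(canRL (mulKf _)) -> := P _ _ xx'; last by rewrite subr_eq0.
have := P _ _ (contraNN _ xx'); rewrite eq_sym => /(_ x' x id).
under eq_bigl do rewrite andbC.
move/(canRL (mulKf _)) => ->; last by rewrite subr_eq0 eq_sym.
have a0 : x - x' != 0 by rewrite subr_eq0 eq_sym.
have b0 : x' - x != 0 by rewrite subr_eq0.
by rewrite !mulrN1 invrN invrK; field.
Qed.

Hypothesis oddq : odd #|F|.

Lemma oppr1_neq1 : (-1 : F) != 1.
Proof.
apply/eqP => e; have two0 : 2%:R = 0 :> F by rewrite mulr2n -{1}e addNr.
have := @sum_expr_eq0 0; rewrite -ltnS prednK ?finNzRing_gt1; last by rewrite (cardD1 0).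
move=> /(_ isT); under eq_bigr do rewrite expr0.
rewrite sumr_const -[#|_|]odd_double_half oddq -muln2 natrD natrM two0 mulr0 addr0.
by move/eqP; rewrite oner_eq0.
Qed.

Lemma two_neq0 : (2%:R : F) != 0.
Proof.
apply: contra_neq oppr1_neq1 => two0.
by apply/eqP; rewrite -subr_eq0 -opprD oppr_eq0 -mulr2n two0.
Qed.

End FiniteField.

(** * The lines b = f x - x m: counting *)

Section GraphLines.
Variables (F : finFieldType) (f : F -> F).
Local Notation q := #|F|.

(** The field element x stands for the line b = f x - x m, and [mult] counts in
addition the line m = 0. *)
Definition lines_at (p : F * F) : {set F} := [set x | f x == x * p.1 + p.2].
Definition mult p : nat := (#|lines_at p| + (p.1 == 0%R))%N.
Definition pt_on x m : F * F := (m, f x - x * m).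
Definition covered : {set F * F} := [set p | (0 < mult p)%N].
Definition odd_pts : {set F * F} := [set p | odd (mult p)].

Lemma pt_on_lines_at x p : (x \in lines_at p) = (pt_on x p.1 == p).
Proof.
by case: p => m b; rewrite inE xpair_eqE eqxx /= subr_eq addrC.
Qed.

Lemma lines_at_pt_on x m : x \in lines_at (pt_on x m).
Proof. by rewrite pt_on_lines_at. Qed.

Lemma sum_flags (g : F * F -> nat) :
  (\sum_x \sum_m g (pt_on x m) = \sum_p #|lines_at p| * g p)%N.
Proof.
transitivity (\sum_p \sum_(x in lines_at p) g p)%N; last first.
  by apply: eq_bigr => p _; rewrite sum_nat_const.
rewrite [RHS](exchange_big_dep predT) //=; apply: eq_bigr => x _.
rewrite (reindex_onto (pt_on x) fst) /=; last first.
  by move=> p; rewrite pt_on_lines_at => /eqP.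
by apply: eq_bigl => m; rewrite lines_at_pt_on eqxx.
Qed.

Lemma sum_vertical m : (\sum_b #|lines_at (m, b)| = q)%N.
Proof.
under eq_bigr do rewrite -sum1_card.
rewrite (exchange_big_dep predT) //= -sum1_card; apply: eq_bigr => x _.
rewrite (bigD1 (f x - x * m)) ?lines_at_pt_on //= big1 // => b.
by rewrite inE /= addrC -subr_eq => /andP[/eqP ->]; rewrite eqxx.
Qed.

(** The points summed over form a line of the same direction as the line x: every
other line y meets it once, and x is disjoint from it or equal to it. *)
Lemma sum_slanted (x k : F) :
  (\sum_m #|lines_at (m, (k - x * m)%R)| = q.-1 + q * (k == f x))%N.
Proof.
under eq_bigr do rewrite -sum1_card.
rewrite (exchange_big_dep predT) //= (bigD1 x) //= addnC; congr addn.
  transitivity (\sum_(y | y != x) 1)%N; last first.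
    by rewrite sum1_card -(cardC1 x).
  apply: eq_bigr => y yx; have yx0 : y - x != 0 by rewrite subr_eq0.
  have E m : (y \in lines_at (m, k - x * m)) = (m == (f y - k) / (y - x)).
    rewrite inE /=; apply/eqP/eqP => [e|->]; last by field.
    by apply: (canRL (mulfK yx0)); rewrite e; ring.
  by under eq_bigl do rewrite E; rewrite big_pred1_eq.
have E m : (x \in lines_at (m, k - x * m)) = (k == f x).
  by rewrite inE /= addrCA subrr addr0 eq_sym.
case: (k == f x) E => E; last by rewrite big_pred0 // muln0.
by rewrite (eq_bigl predT) // sum_nat_const.
Qed.

(** Here the line x itself contributes q and each of the q others contributes 1. *)
Lemma sum_line x : (\sum_m mult (pt_on x m) = q * 2)%N.
Proof.
rewrite big_split /= sum_slanted eqxx muln1 (bigD1 0) //= eqxx big1 => [|m].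
  by rewrite addn0 addnAC addn1 prednK ?addnn ?muln2 // (cardD1 0).
by move/negPf->.
Qed.

Lemma sum_infty (g : F * F -> nat) :
  (\sum_p (p.1 == 0%R) * g p = \sum_b g (0%R, b))%N.
Proof.
rewrite (eq_bigr (fun p => (p.1 == 0%R) * g (p.1, p.2))%N) => [|[] //].
rewrite -(pair_bigA _ (fun m b => (m == 0%R) * g (m, b))%N) /=.
rewrite (bigD1 0) //= [X in (_ + X)%N]big1 => [|m /negPf->]; last by rewrite big1.
rewrite addn0.
by apply: eq_bigr => b _; rewrite eqxx mul1n.
Qed.

Lemma sum_mult : (\sum_p mult p = q * q + q)%N.
Proof.
rewrite big_split /=; congr addn.
  under eq_bigr do rewrite -[#|_|]muln1.
  by rewrite -(sum_flags (fun=> 1%N)) !sum_nat_const !muln1.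
under eq_bigr do rewrite -[nat_of_bool _]muln1.
by rewrite (sum_infty (fun=> 1%N)) sum_nat_const muln1.
Qed.

Lemma sum_mult_sqr : (\sum_p mult p * mult p = 2 * (q * q) + 2 * q)%N.
Proof.
rewrite (eq_bigr (fun p => #|lines_at p| * mult p + (p.1 == 0%R) * mult p)%N); last first.
  by move=> p _; rewrite -mulnDl.
rewrite big_split /= -sum_flags sum_infty.
under eq_bigr do rewrite sum_line.
rewrite sum_nat_const; under [X in (_ + X)%N]eq_bigr do rewrite /mult eqxx.
rewrite big_split /= sum_vertical sum_nat_const.
by set n := #|F|; lia.
Qed.

(** The quadratic 4 k - k^2 agrees with 4 [0 < k] - [k odd] at k = 0, 1, 2, 3 and
lies below it afterwards; 4 k - k^2 is 3 k - k (k - 1), a combination of the two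
quantities whose sums over the plane are known. *)
Lemma mult_weight k : (odd k + 4 * k <= 4 * (0 < k) + k * k ?= iff (k <= 3))%N.
Proof.
case: k => [|[|[|[|k]]]] //; apply/leqifP => /=.
by case: (odd k); nia.
Qed.

Lemma covered_count :
  (#|odd_pts| + 2 * (q * q + q) <= 4 * #|covered|
     ?= iff [forall p, (mult p <= 3)%N])%N.
Proof.
have E1 : (\sum_p (odd (mult p) + 4 * mult p) = #|odd_pts| + 4 * (q * q + q))%N.
  by rewrite big_split sum_bool -big_distrr sum_mult.
have E2 : (\sum_p (4 * (0 < mult p) + mult p * mult p)
           = 4 * #|covered| + 2 * (q * q + q))%N.
  by rewrite big_split -big_distrr sum_bool sum_mult_sqr mulnDr.
have [le eq] := leqif_sum (fun p (_ : p \in predT) => mult_weight (mult p)).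
move: le eq; rewrite E1 E2; set N := (q * q + q)%N; set o := #|_|; set c := #|_|.
move=> le eq; split; first by lia.
have <- : [forall (i | predT i), (mult i <= 3)%N] = [forall p, (mult p <= 3)%N] by [].
by rewrite -eq; lia.
Qed.

(** * Odd points *)

Hypothesis oddq : odd q.

Definition even_line x := [forall m, ~~ odd (mult (pt_on x m))].
Definition even_infty := [forall b, ~~ odd (mult (0, b))].

Lemma lines_at_gt0 x m : (0 < #|lines_at (pt_on x m)|)%N.
Proof. by apply/card_gt0P; exists x; apply: lines_at_pt_on. Qed.

(** The odd points meet every affine line other than the q + 1 given ones, because
the multiplicities along such a line add up to q. When m = 0 has no odd point,
its point (0, 0) is added in order to meet it too. *)
Lemma card_odd_pts : (forall x, ~~ even_line x) ->
  (2 * q - 1 <= #|odd_pts| + even_infty)%N.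
Proof.
move=> neven.
pose S := odd_pts :|: [set p | even_infty && (p == (0, 0))].
apply: (@leq_trans #|S|); last first.
  apply: leq_trans (leq_card_setU _ _) _; rewrite leq_add2l.
  case: even_infty; last first.
    by rewrite (_ : [set p | _] = set0) ?cards0 //; apply/setP=> p; rewrite !inE.
  by rewrite (_ : [set p | _] = [set (0, 0)]) ?cards1 //; apply/setP=> p; rewrite !inE.
apply: affine_blocking_set => a b c; have [->|b0 _] := eqVneq b 0.
  rewrite orbF => a0; set m := c / a.
  have [m0|m0] := eqVneq m 0.
    case cl: even_infty.
      exists (0, 0); first by rewrite !inE cl eqxx orbT.
      by rewrite !mulr0 addr0 -[c](divfK a0) -/m m0 mul0r.
    move/negbT: cl; rewrite negb_forall => /existsP[k /negPn ok].
    exists (0, k); first by rewrite !inE ok.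
    by rewrite mulr0 mul0r addr0 -[c](divfK a0) -/m m0 mul0r.
  have /odd_sum_ex[k ok] : odd (\sum_k mult (m, k)).
    by rewrite big_split /= sum_vertical (negPf m0) big1 // addn0.
  exists (m, k); first by rewrite !inE ok.
  by rewrite mul0r addr0 mulrC divfK.
set x := a / b; set k := c / b.
have on m : a * m + b * (k - x * m) = c by rewrite /x /k; field.
have [kx|kx] := eqVneq k (f x).
  have := neven x; rewrite negb_forall => /existsP[m /negPn om].
  by exists (pt_on x m); rewrite ?inE ?om //= -kx on.
have /odd_sum_ex[m om] : odd (\sum_m mult (m, (k - x * m)%R)).
  rewrite big_split /= sum_slanted (negPf kx) muln0 addn0 (bigD1 0) //= eqxx.
  by rewrite big1 => [|i /negPf-> //]; rewrite addn0 addn1 prednK // (cardD1 0).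
by exists (m, k - x * m); rewrite ?inE ?om //= on.
Qed.

(** Two lines x and y with f x = f y cross on m = 0, at a point which would have
multiplicity at least 3. *)
Lemma even_infty_inj : even_infty -> injective f.
Proof.
move=> /forallP cl x y fxy.
have pos b : (0 < mult (0%R, b))%N by rewrite /mult eqxx addn1.
have m2 : mult (0, f x) = 2%N.
  apply: (sum_even_pos pos cl).
  by rewrite big_split /= sum_vertical eqxx sum_nat_const muln1 muln2 addnn.
have /cards1P[z Ez] : #|lines_at (0, f x)| == 1%N.
  by move: m2; rewrite /mult eqxx addn1 => -[->].
have xz : x \in lines_at (0, f x) by rewrite inE mulr0 add0r.
have yz : y \in lines_at (0, f x) by rewrite inE mulr0 add0r fxy.
by move: xz yz; rewrite Ez !inE => /eqP-> /eqP->.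
Qed.

(** The abscissa of the intersection of the lines x and y; it is also the slope of
the chord of the graph of f between x and y. *)
Definition meet x y := (f y - f x) / (y - x).

Lemma meetP x y m : y != x -> (meet x y == m) = (y \in lines_at (pt_on x m)).
Proof.
rewrite -subr_eq0 inE /= => yx; apply/eqP/eqP => [<-|e]; rewrite /meet; first by field.
by rewrite e; field.
Qed.

Lemma prod_meet x (phi : F -> F) :
  \prod_(y | y != x) phi (meet x y)
  = \prod_m phi m ^+ (#|lines_at (pt_on x m)|.-1).
Proof.
rewrite (partition_big (meet x) predT) //=; apply: eq_bigr => m _.
rewrite (eq_bigr (fun=> phi m)) => [|y /andP[_ /eqP->] //].
rewrite prodr_const; congr (_ ^+ _).
rewrite (cardsD1 x (lines_at _)) lines_at_pt_on /=.
by apply: eq_card => y; rewrite !inE unfold_in; case: eqVneq => //= yx; rewrite meetP // inE.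
Qed.

(** Numerators and denominators both run over all nonzero elements. *)
Lemma prod_meet_inj x : injective f -> \prod_(y | y != x) meet x y = 1.
Proof.
move=> finj; rewrite big_split /= prodfV.
have P (g : F -> F) : injective g -> \prod_(y | y != x) (g y - g x) = -1.
  move=> ginj; rewrite -(prod_nonzero F) [RHS](reindex_inj (h := fun y => g y - g x)) /=.
    by apply: eq_bigl => y; rewrite subr_eq0 inj_eq.
  by move=> y z /addIr/ginj.
by rewrite (P f) // (P id) // divff // oppr_eq0 oner_eq0.
Qed.

(** On a second line without odd points the abscissae of the intersections with
the remaining lines are all the nonzero elements, so their product is -1, and it
is 1 since f is a permutation. *)
Lemma even_infty_unique x : even_infty -> ~~ even_line x.
Proof.
move=> cli; apply/negP => /forallP clx.
have pos m : (0 < mult (pt_on x m))%N by rewrite addn_gt0 lines_at_gt0.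
have m2 := sum_even_pos pos clx (sum_line x).
have := prod_meet_inj x (even_infty_inj cli).
rewrite (prod_meet x id) => e; case/eqP: (oppr1_neq1 oddq); rewrite -[RHS]e.
rewrite -(prod_nonzero F) big_mkcond; apply: eq_bigr => m _.
by have := m2 m; rewrite /mult /=; case: eqVneq; rewrite ?addn0 ?addn1 => _ [->].
Qed.

(** * The extremal configurations *)

Section Extremal.
Hypothesis cli : even_infty.
Hypothesis mult_le3 : forall p, (mult p <= 3)%N.
Hypothesis card_odd : #|odd_pts| = (2 * q - 2)%N.

Let finj : injective f := even_infty_inj cli.

Definition points_of_mult k : {set F * F} := [set p | mult p == k].
Local Notation triple := (points_of_mult 3).
Definition abscissae k x : {set F} := [set m | mult (pt_on x m) == k].
Local Notation d x := #|abscissae 3 x|.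

Lemma mult_infty p : p.1 = 0 -> mult p = 2%N.
Proof.
case: p => m b /= ->; rewrite /mult eqxx addn1; congr _.+1.
apply/eqP; rewrite eqn_leq; apply/andP; split.
  apply/card_le1_eqP => x y; rewrite !inE !mulr0 => /eqP fx /eqP fy.
  by apply: finj; rewrite fx fy.
have [g _ gK] : bijective f := injF_bij finj.
by apply/card_gt0P; exists (g b); rewrite inE gK mulr0 add0r.
Qed.

Lemma mult_affine p : p.1 != 0 -> mult p = #|lines_at p|.
Proof. by rewrite /mult => /negPf->; rewrite addn0. Qed.

Lemma mult_not2 p : mult p != 2%N -> p.1 != 0 /\ mult p = #|lines_at p|.
Proof.
move=> m2; suff p0 : p.1 != 0 by split=> //; apply: mult_affine.
by apply: contraNneq m2 => /mult_infty->.
Qed.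

Lemma mult_pt_on_gt0 x m : (0 < mult (pt_on x m))%N.
Proof. by rewrite addn_gt0 lines_at_gt0. Qed.

(** The multiplicities along the line x lie between 1 and 3 and average 2. *)
Lemma card_abscissae13 x : #|abscissae 1 x| = d x.
Proof.
have : (\sum_m (mult (pt_on x m) + (mult (pt_on x m) == 1))
      = \sum_(m : F) (2 + (mult (pt_on x m) == 3)))%N.
  apply: eq_bigr => m _; move: (mult_pt_on_gt0 x m) (mult_le3 (pt_on x m)).
  by case: (mult _) => [|[|[|[|]]]].
rewrite big_split [RHS]big_split /= sum_line !sum_bool sum_nat_const.
by move/addnI.
Qed.

Lemma card_abscissae3_gt0 x : (0 < d x)%N.
Proof.
have := even_infty_unique x cli.
rewrite negb_forall => /existsP[m /negPn]; move: (mult_pt_on_gt0 x m) (mult_le3 (pt_on x m)).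
case E: (mult _) => [|[|[|[|]]]] // _ _ _.
  by rewrite -card_abscissae13; apply/card_gt0P; exists m; rewrite inE E.
by apply/card_gt0P; exists m; rewrite inE E.
Qed.

Lemma sum_card_abscissae k : k != 2%N ->
  (\sum_x #|abscissae k x| = k * #|points_of_mult k|)%N.
Proof.
move=> k2; under eq_bigr do rewrite -sum_bool.
rewrite (sum_flags (fun p => mult p == k)) -sum_bool big_distrr.
apply: eq_bigr => p _ /=; case: eqVneq => [E|]; last by rewrite !muln0.
by have [|_ <-] := @mult_not2 p; rewrite E.
Qed.

(** Counted through the lines containing them, simple points are three times as
many as triple points, and both together number 2 q - 2. *)
Lemma card_triple : (2 * #|triple| + 1 = q)%N.
Proof.
have E : #|odd_pts| = (#|points_of_mult 1| + #|triple|)%N.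
  rewrite /points_of_mult /odd_pts -(sum_bool (fun p => mult p == 1%N)).
  rewrite -(sum_bool (fun p => mult p == 3)).
  rewrite -(sum_bool (fun p => odd (mult p))) -big_split; apply: eq_bigr => p _ /=.
  by move: (mult_le3 p); case: (mult _) => [|[|[|[|]]]].
have E1 : (\sum_x #|abscissae 1 x| = \sum_x d x)%N.
  by apply: eq_bigr => x _; apply: card_abscissae13.
move: E1 E; rewrite !sum_card_abscissae // card_odd.
have : (0 < q)%N by rewrite (cardD1 0).
move: oddq; set n := #|F|; set a := #|_|; set b := #|_|; lia.
Qed.

(** A line with a single triple point has a single simple point as well. *)
Definition ordinary : {set F} := [set x | d x == 1%N].

(** Each of the q lines has at least one triple point and the non-ordinary ones at
least two, while there are only 3 (q - 1) / 2 incidences. *)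
Lemma card_ordinary_triple : (#|triple| < #|ordinary|)%N.
Proof.
have := sum_card_abscissae (isT : 3 != 2%N).
have le : (\sum_(x : F) (2 - (x \in ordinary)) <= \sum_x d x)%N.
  apply: leq_sum => x _; rewrite inE.
  by case: eqVneq => [->//|]; move: (card_abscissae3_gt0 x); case: (d x) => [|[]].
have : (\sum_(x : F) (2 - (x \in ordinary)) + #|ordinary| = 2 * q)%N.
  rewrite -sum1_card [X in (_ + X)%N]big_mkcond -big_split /= mulnC -sum_nat_const.
  by apply: eq_bigr => x _; case: ifP.
move: le card_triple.
set n := #|F|; set a := #|_|; set b := #|_|; set c := (\sum__ _)%N; set e := (\sum__ _)%N; lia.
Qed.

(** The other lines meet x once at every nonzero abscissa, except twice at the
triple point s and never at the simple point t. Any function phi may be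
multiplied over this multiset; this freedom is what [prod_meet_pair] needs. *)
Lemma prod_meet_ordinary x s t (phi : F -> F) :
    abscissae 3 x = [set s] -> abscissae 1 x = [set t] ->
  (\prod_(y | y != x) phi (meet x y)) * phi t = (\prod_(m | m != 0) phi m) * phi s.
Proof.
move=> Es Et; rewrite prod_meet.
have E u : phi u = \prod_m (if m == u then phi m else 1).
  by rewrite -big_mkcond big_pred1_eq.
rewrite (E s) (E t) [\prod_(m | m != 0) _]big_mkcond -!big_split.
apply: eq_bigr => m _ /=.
have ms : (m == s) = (mult (pt_on x m) == 3) by rewrite -in_set1 -Es inE.
have mt : (m == t) = (mult (pt_on x m) == 1%N) by rewrite -in_set1 -Et inE.
have [m0|m0] := eqVneq m 0.
  rewrite ms mt mult_infty //=; have := @mult_infty (pt_on x m) m0.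
  by rewrite /mult m0 eqxx addn1 => -[->].
rewrite ms mt; move: (mult_pt_on_gt0 x m) (mult_le3 (pt_on x m)).
rewrite mult_affine //=; case: #|_| => [|[|[|[|]]]] //= _ _.
- by rewrite !mulr1 expr0 mul1r.
- by rewrite !mulr1.
Qed.

(** With phi the identity the left side is t and the right side is - s. *)
Lemma ordinary_abscissae x : x \in ordinary ->
  exists2 s, abscissae 3 x = [set s] & abscissae 1 x = [set - s].
Proof.
rewrite inE => dx; have /cards1P[s Es] := dx.
move: dx; rewrite -card_abscissae13 => /cards1P[t Et].
exists s => //; suff -> : - s = t by [].
have := prod_meet_ordinary id Es Et.
by rewrite prod_meet_inj // mul1r prod_nonzero mulN1r.
Qed.

Lemma meet_neq0 x y : y != x -> meet x y != 0.
Proof.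
by move=> yx; rewrite mulf_neq0 ?invr_eq0 ?subr_eq0 // (inj_eq finj).
Qed.

Lemma pt_on_meet x y : y != x -> pt_on x (meet x y) = pt_on y (meet x y).
Proof.
move=> yx; have := meetP (meet x y) yx; rewrite eqxx.
by move/esym; rewrite pt_on_lines_at => /eqP.
Qed.

Section Pair.
Variables (x x' s s' : F).
Hypotheses (xx' : x' != x).
Hypotheses (Es : abscissae 3 x = [set s]) (Et : abscissae 1 x = [set - s]).
Hypotheses (Es' : abscissae 3 x' = [set s']) (Et' : abscissae 1 x' = [set - s']).
Local Notation m0 := (meet x x').

(* phi takes the value 1 at m0 so that the lines through the common point, in
   particular x and x' themselves, contribute nothing. *)
Let phi m := if m == m0 then 1 else m - m0.

(** Segre's lemma of tangents for the triangle formed by x, x' and the line at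
infinity. A line y avoiding the common point of x and x', of abscissa m0, meets
x at an abscissa whose difference from m0 is g y / (y - x), where g y is the
vertical distance from that point to y. It is the same for x', so g cancels when
the products over the intersections with x and with x' are compared. *)
Lemma prod_meet_pair :
  phi s * phi (- s')
  = (\prod_(y | y \notin lines_at (pt_on x m0)) ((y - x') / (y - x)))
    * (phi s' * phi (- s)).
Proof.
have phi0 m : phi m != 0.
  by rewrite /phi; case: ifP => [_|/negbT mm]; [exact: oner_neq0 | rewrite subr_eq0].
pose g y := f y - f x - m0 * (y - x).
have gE y : (g y == 0) = (y \in lines_at (pt_on x m0)).
  rewrite inE /= /g -[RHS]subr_eq0; apply: (congr1 (fun u => u == 0)); ring.
have P z : z \in lines_at (pt_on x m0) ->
    \prod_(y | y != z) phi (meet z y)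
    = \prod_(y | y \notin lines_at (pt_on x m0)) (g y / (y - z)).
  move=> zl; have gz : f z = f x + m0 * (z - x).
    by apply/eqP; rewrite -subr_eq0 opprD addrA; move: zl; rewrite -gE.
  transitivity (\prod_(y | (y != z) && (y \notin lines_at (pt_on x m0))) (g y / (y - z))).
    rewrite big_mkcondr; apply: eq_bigr => y yz; rewrite -gE /phi.
    have yz0 : y - z != 0 by rewrite subr_eq0.
    have -> : g y = (meet z y - m0) * (y - z).
      have K : meet z y * (y - z) = f y - f z by rewrite divfK.
      by rewrite mulrBl K gz /g; ring.
    by rewrite mulf_eq0 (negPf yz0) orbF subr_eq0 mulfK //; case: eqP.
  by apply: eq_bigl => y; case: eqVneq => //= ->; rewrite zl.
have Px := P x (lines_at_pt_on x m0).
have x'l : x' \in lines_at (pt_on x m0) by rewrite pt_on_meet // lines_at_pt_on.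
have Px' := P x' x'l.
have := prod_meet_ordinary phi Es Et; have := prod_meet_ordinary phi Es' Et'.
rewrite Px Px'; set Z := \prod_(m | m != 0) _; set G := \prod_(y | _) (_ / (y - x')).
have -> : \prod_(y | y \notin lines_at (pt_on x m0)) (g y / (y - x)) =
   G * \prod_(y | y \notin lines_at (pt_on x m0)) ((y - x') / (y - x)).
  rewrite -big_split; apply: eq_bigr => y yl /=.
  have y0 : y - x' != 0 by rewrite subr_eq0; apply: contraNneq yl => ->.
  by rewrite mulrA divfK.
set rho := \prod_(y | _) _ => e' e.
have Z0 : Z != 0 by apply/prodf_neq0.
apply: (mulfI Z0); transitivity (Z * phi s * phi (- s')); first by ring.
transitivity (Z * phi s' * (rho * phi (- s))); last by ring.
by rewrite -e -e'; ring.
Qed.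

Local Notation L := (lines_at (pt_on x m0)).

Let lx : x \in L. Proof. exact: lines_at_pt_on. Qed.
Let lx' : x' \in L. Proof. by rewrite pt_on_meet // lines_at_pt_on. Qed.
Let mE : mult (pt_on x m0) = #|L|.
Proof. by apply: mult_affine; apply: meet_neq0. Qed.
Let cardL : #|L| = (#|L :\ x :\ x'|).+2.
Proof. by rewrite (cardsD1 x) lx (cardsD1 x') 2!inE xx' lx'. Qed.
Let ms : (s == m0) = (mult (pt_on x m0) == 3).
Proof. by rewrite eq_sym -in_set1 -Es inE. Qed.
Let ms' : (s' == m0) = (mult (pt_on x m0) == 3).
Proof. by rewrite eq_sym -in_set1 -Es' inE pt_on_meet. Qed.
Let mt : (- s == m0) = false.
Proof. by rewrite eq_sym -in_set1 -Et inE mE cardL. Qed.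
Let mt' : (- s' == m0) = false.
Proof. by rewrite eq_sym -in_set1 -Et' inE -pt_on_meet // mE cardL. Qed.

(** If x and x' meet in a triple point then s = s' = m0. Otherwise only x and x'
pass through their common point, the product in [prod_meet_pair] is -1 by
[prod_ratio], and the relation becomes s s' = m0^2. *)
Lemma pair_abscissae : s * s' * (x' - x) ^+ 2 = (f x' - f x) ^+ 2.
Proof.
have xx0 : x' - x != 0 by rewrite subr_eq0.
suff -> : s * s' = m0 ^+ 2 by rewrite -exprMn divfK.
have [m3|m3] := eqVneq (mult (pt_on x m0)) 3.
  by move: ms ms'; rewrite m3 => /eqP-> /eqP->; rewrite expr2.
have := prod_meet_pair; rewrite /phi ms ms' mt mt' (negPf m3).
have L0 : L :\ x :\ x' = set0.
  apply/eqP; rewrite -cards_eq0; have := mult_le3 (pt_on x m0).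
  by move: m3; rewrite mE cardL; case: #|_| => [|[]].
rewrite (eq_bigl (fun y => (y != x) && (y != x'))) => [|y]; last first.
  have : (y \in L :\ x :\ x') = false by rewrite L0 inE.
  rewrite !in_setD1; case: (eqVneq y x) => [->|_] /=; first by rewrite lx.
  by case: (eqVneq y x') => [->|_] /= => [|->//]; rewrite lx'.
rewrite prod_ratio // mulN1r => e.
apply: (mulfI (two_neq0 oddq)); apply/eqP; rewrite -subr_eq0; apply/eqP.
by transitivity ((s' - m0) * (- s - m0) * (-1) - (s - m0) * (- s' - m0)); [ring | rewrite e; ring].
Qed.

(** Now s = s' = m0, so all values of phi cancel and the product over the lines
avoiding the triple point is 1. By [prod_ratio] the factor missing for r is then
(r - x') / (r - x) = -1. *)
Lemma pair_midpoint r : s = m0 -> r \in L -> r != x -> r != x' -> r + r = x + x'.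
Proof.
move=> sm rl rx rx'; have m3 : (mult (pt_on x m0) == 3) by rewrite -ms sm.
have := prod_meet_pair; rewrite /phi ms ms' mt mt' m3.
have -> : s' = s by rewrite sm; apply/eqP; rewrite ms'.
have sm0 : - s - m0 != 0 by rewrite subr_eq0 mt.
rewrite !mul1r -[LHS]mul1r => /(mulIf sm0) /esym e.
have Lr : L :\ x :\ x' = [set r].
  apply/esym/eqP; rewrite eqEcard cards1 sub1set !inE rx rx' /=.
  have := rl; rewrite inE => -> /=.
  by move: m3; rewrite mE cardL => /eqP[->].
have := prod_ratio xx'; rewrite (bigD1 r) ?rx //=.
rewrite (eq_bigl (fun y => y \notin L)) => [|y]; last first.
  have : (y \in L :\ x :\ x') = (y == r) by rewrite Lr inE.
  rewrite !in_setD1; case: (eqVneq y x) => [->|_] /=; first by rewrite lx.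
  case: (eqVneq y x') => [->|_] /=; first by rewrite lx'.
  by move=> ->.
rewrite e mulr1 => h; have r0 : r - x != 0 by rewrite subr_eq0.
have : r - x' = - (r - x) by rewrite -[LHS](divfK r0) h mulN1r.
by move=> h'; rewrite -[x'](subKr r) h'; ring.
Qed.
End Pair.

(** Ordinary lines outnumber triple points, so two of them, x and x', share one;
c is the third line there, the midpoint of x and x'. Represent each line x by the
point (x, f x) of the dual plane and put the origin at (c, f c): then x and x'
become (a, s a) and (- a, - s a), and for an ordinary line with coordinates (X, Y) and triple point at t the relations
(Y - s a)^2 = s t (X - a)^2 and (Y + s a)^2 = s t (X + a)^2 subtract to Y = t X,
which says that c passes through that triple point. *)
Lemma ordinary_centre : exists c,
  forall x, x \in ordinary -> forall m, m \in abscissae 3 x -> c \in lines_at (pt_on x m).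
Proof.
pose sec x := odflt 0 [pick s in abscissae 3 x].
have secE x s : abscissae 3 x = [set s] -> sec x = s.
  rewrite /sec => Es; case: pickP => [t|/(_ s)]; rewrite Es inE ?eqxx //.
  by move/eqP.
have /dinjectivePn[x Ox [x' x'P e]] :
    ~~ dinjectiveb (fun x => pt_on x (sec x)) ordinary.
  apply/negP => /dinjectiveP inj; have := card_ordinary_triple.
  rewrite ltnNge -(card_in_imset inj) subset_leq_card //.
  apply/subsetP => p /imsetP[x /ordinary_abscissae[s Es _] ->].
  have ss : s \in abscissae 3 x by rewrite Es set11.
  by move: ss; rewrite !inE (secE _ _ Es).
have [xx' Ox'] : x' != x /\ x' \in ordinary by apply/andP; move: x'P; rewrite inE.
have [s Es Et] := ordinary_abscissae Ox.
have [s' Es' Et'] := ordinary_abscissae Ox'.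
move: e; rewrite (secE _ _ Es) (secE _ _ Es') => -[ss' fx]; subst s'.
have lx' : x' \in lines_at (pt_on x s) by rewrite pt_on_lines_at /pt_on /= -fx.
have sm : s = meet x x' by apply/esym/eqP; rewrite meetP.
have [c [cl cx cx']] : exists c, [/\ c \in lines_at (pt_on x s), c != x & c != x'].
  have : s \in abscissae 3 x by rewrite Es set11.
  rewrite inE mult_affine /=; last by rewrite sm meet_neq0.
  rewrite (cardsD1 x) lines_at_pt_on (cardsD1 x') 2!inE xx' lx' => /eqP[/eqP].
  case/cards1P=> c Ec; have : c \in lines_at (pt_on x s) :\ x :\ x' by rewrite Ec set11.
  by rewrite 2!in_setD1 => /and3P[? ? ?]; exists c.
have mid : c + c = x + x'.
  by apply: (pair_midpoint xx' Es Et Es' Et' sm); rewrite // -sm.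
exists c => y Oy m; have [t Es2 Et2] := ordinary_abscissae Oy.
rewrite Es2 inE => /eqP->.
have fc : f c = f x + s * (c - x).
  by move: cl; rewrite inE /= => /eqP->; ring.
have [yx|yx] := eqVneq y x.
  move: Es2; rewrite yx Es => /setP/(_ t); rewrite !inE eqxx => /eqP ->.
  by move: cl; rewrite inE.
have [yx'|yx'] := eqVneq y x'.
  move: Es2; rewrite yx' Es' => /setP/(_ t); rewrite !inE eqxx => /eqP ->.
  by move: cl; rewrite /pt_on fx inE.
have h := pair_abscissae yx Es Et Es2 Et2.
have h' := pair_abscissae yx' Es' Et' Es2 Et2.
have s0 : s != 0 by rewrite sm meet_neq0.
have xc : c - x != 0 by rewrite subr_eq0.
have x'E : x' = c + c - x by rewrite mid; ring.
have fx'E : f x' = f c + s * (c - x).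
  by move: lx'; rewrite inE /= => /eqP->; rewrite fc x'E; ring.
have fxE : f x = f c - s * (c - x) by rewrite fc; ring.
rewrite inE /=; apply/eqP.
apply: (mulfI (mulf_neq0 (two_neq0 oddq) (mulf_neq0 (two_neq0 oddq) (mulf_neq0 s0 xc)))).
apply/eqP; rewrite -subr_eq0; apply/eqP.
transitivity (s * t * (y - x) ^+ 2 - (f y - f x) ^+ 2
              - (s * t * (y - x') ^+ 2 - (f y - f x') ^+ 2)).
  by rewrite fx'E fxE x'E; ring.
by rewrite h h' !subrr.
Qed.

(** Let d be the number of triple points on the centre c. The triple points of the
ordinary lines are among them, and each lies on two lines besides c, so at most
2 d ordinary lines differ from c; the remaining lines have two triple points or
more. Compared with the 3 (q - 1) / 2 incidences this gives d >= (q - 1) / 2. *)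
Lemma triple_concurrent : exists c, forall p, mult p = 3 -> c \in lines_at p.
Proof.
have [c cP] := ordinary_centre; exists c.
pose A := ordinary :\ c.
have cardA : (#|A| <= d c * 2)%N.
  have sub : A \subset \bigcup_(m in abscissae 3 c) (lines_at (pt_on c m) :\ c).
    apply/subsetP => x /setD1P[xc Ox]; have [s Es _] := ordinary_abscissae Ox.
    have ss : s \in abscissae 3 x by rewrite Es set11.
    have := cP x Ox s ss; rewrite pt_on_lines_at => /eqP e.
    apply/bigcupP; exists s; last by rewrite in_setD1 xc e lines_at_pt_on.
    by move: ss; rewrite !inE e.
  apply: leq_trans (subset_leq_card sub) _; apply: leq_trans (card_bigcup_le _ _) _.
  rewrite -sum_nat_const; apply: leq_sum => m; rewrite inE => /eqP m3.
  have [|_] := @mult_not2 (pt_on c m); first by rewrite m3.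
  by rewrite m3 (cardsD1 c) lines_at_pt_on add1n => -[<-].
have le : (\sum_(x | x != c) (2 - (x \in A)) + d c <= \sum_x d x)%N.
  rewrite [X in (_ <= X)%N](bigD1 c) //= addnC leq_add2l.
  apply: leq_sum => x xc; rewrite in_setD1 xc inE /=.
  by case: eqVneq => [->//|]; move: (card_abscissae3_gt0 x); case: (d x) => [|[]].
have eq : (\sum_(x | x != c) (2 - (x \in A)) + #|A| = 2 * q.-1)%N.
  rewrite -(cardC1 c) mulnC -sum_nat_const -sum1_card.
  rewrite [X in (_ + X)%N](eq_bigl (fun x => (x != c) && (x \in A))) => [|x]; last first.
    by rewrite in_setD1; case: eqVneq.
  rewrite [X in (_ + X)%N]big_mkcondr -big_split /=.
  by apply: eq_bigr => x _; case: (x \in A).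
have dT : (#|triple| <= d c)%N.
  move: le eq cardA; rewrite sum_card_abscissae //; move: card_triple.
  set t := #|triple|; set n := #|F|; set a := #|A|; set k := d c.
  set e := (\sum_(x | _) _)%N; lia.
have /eqP E : [set pt_on c m | m in abscissae 3 c] == triple.
  rewrite eqEcard card_imset ?dT ?andbT => [|m m' []//].
  by apply/subsetP => _ /imsetP[m mc ->]; move: mc; rewrite !inE.
move=> p p3; have : p \in triple by rewrite inE p3.
by rewrite -E => /imsetP[m _ ->]; apply: lines_at_pt_on.
Qed.
End Extremal.

(** * Number of covered points *)

Local Notation kmin := ((q * (q + 1)) %/ 2 + (q - 1) %/ 2)%N.

Lemma kmin4 : (4 * kmin = 2 * (q * q + q) + (2 * q - 2))%N.
Proof.
have [k ->] : exists k, #|F| = k.*2.+1.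
  by exists #|F|./2; rewrite -[LHS]odd_double_half oddq.
have -> : (k.*2.+1 * (k.*2.+1 + 1) = k.*2.+1 * k.+1 * 2)%N by nia.
have -> : (k.*2.+1 - 1 = k * 2)%N by lia.
by rewrite !mulnK //; nia.
Qed.

(** The hypothesis says that m = 0 is chosen without odd points as soon as one of
the q + 1 lines has none. *)
Lemma card_covered_ge : (forall x, even_line x -> even_infty) ->
  (kmin <= #|covered|)%N /\
  (#|covered| = kmin -> (forall p, mult p <= 3)%N /\
     exists c, forall p, mult p = 3 -> c \in lines_at p).
Proof.
move=> ncl.
have /(card_odd_pts) card : forall x, ~~ even_line x.
  by move=> x; apply/negP => cx; have := even_infty_unique x (ncl _ cx); rewrite cx.
have [le eq] := covered_count; have k4 := kmin4.
have lo : (2 * q - 2 <= #|odd_pts|)%N.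
  by move: card; case: (even_infty); set a := #|F|; set b := #|_|; lia.
split.
  rewrite -(leq_pmul2l (isT : 0 < 4)%N) k4; apply: leq_trans le.
  by rewrite addnC leq_add2r.
move=> kE; move: le eq; rewrite kE k4 => le eq.
have card_odd : #|odd_pts| = (2 * q - 2)%N.
  by apply/eqP; rewrite eqn_leq lo andbT; move: le; rewrite addnC leq_add2l.
move: eq; rewrite card_odd addnC eqxx => /esym/forallP m3; split=> //.
apply: triple_concurrent => //; move: card; rewrite card_odd; case: even_infty => //.
have : (1 < #|F|)%N by apply: finNzRing_gt1.
by set a := #|F|; lia.
Qed.

(** A line x is crossed by the q - 1 others at distinct abscissae, so it has a
single point on no other line x'. These q points are spread over the q lines
m = constant, each of which contains an odd number of them; so there is exactly
one with m = 0, which is all that the count of covered points requires. *)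
Lemma card_covered_le2 : (forall p, #|lines_at p| <= 2)%N -> #|covered| = kmin.
Proof.
move=> le2.
pose single p : bool := #|lines_at p| == 1%N.
have single_x x : (\sum_m single (pt_on x m) = 1)%N.
  apply/(@addnI (q.-1 + q)%N).
  have := sum_slanted x (f x); rewrite eqxx muln1 => {1}<-; rewrite -big_split /=.
  transitivity (\sum_(m : F) 2)%N.
    apply: eq_bigr => m _; rewrite /single.
    by move: (le2 (pt_on x m)) (lines_at_gt0 x m); case: #|_| => [|[|[|]]].
  rewrite sum_nat_const; have : (0 < q)%N by rewrite (cardD1 0).
  by set a := #|F|; lia.
have single_pt : (\sum_p single p = q)%N.
  transitivity (\sum_x \sum_m single (pt_on x m))%N.
    rewrite (sum_flags single); apply: eq_bigr => p _; rewrite /single.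
    by case: eqVneq => [->|]; rewrite ?muln0.
  by under eq_bigr do rewrite single_x; rewrite sum_nat_const muln1.
have single_m : (\sum_b single (0%R, b) = 1)%N.
  have odd_m m : odd (\sum_b single (m, b)).
    have := sum_vertical m.
    rewrite (eq_bigr (fun b => single (m, b) + (#|lines_at (m, b)| == 2) * 2))%N; last first.
      by move=> b _; rewrite /single; move: (le2 (m, b)); case: #|_| => [|[|[|]]].
    by rewrite big_split -big_distrl /= => e; move: oddq; rewrite -e oddD oddM andbF addbF.
  have ge1 m : (m \in predT) ->
      (1 <= \sum_b single (m, b) ?= iff (1%N == \sum_b single (m, b)%N))%N.
    by move=> _; split=> //; apply: odd_gt0.
  have [_] := leqif_sum ge1.
  rewrite sum_nat_const muln1 pair_bigA /=.
  rewrite (eq_bigr (fun p => nat_of_bool (single p))) => [|[] //].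
  by rewrite single_pt eqxx => /esym/forallP/(_ 0)/eqP.
have : (2 * #|covered| + (q + \sum_b single (0%R, b)) = q * q + q + q * 2)%N.
  rewrite -{1}(sum_vertical 0) -big_split /=.
  rewrite -(sum_infty (fun p => #|lines_at p| + single p)%N).
  rewrite /covered -sum_bool big_distrr -big_split /=.
  have E p : (2 * (0 < mult p) + (p.1 == 0%R) * (#|lines_at p| + single p)
           = #|lines_at p| * 1 + single p + (p.1 == 0%R) * 2)%N.
    rewrite /single /mult; move: (le2 p).
    by move: #|lines_at p| => [|[|[|n]]] //; case: (p.1 == 0%R).
  under eq_bigr do rewrite E.
  rewrite !big_split /= -(sum_flags (fun=> 1%N)) single_pt (sum_infty (fun=> 2%N)).
  by rewrite !sum_nat_const !muln1.
rewrite single_m => e; apply/eqP; rewrite -(eqn_pmul2l (isT : 0 < 4)%N) kmin4; apply/eqP.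
have : (1 < #|F|)%N by apply: finNzRing_gt1.
by move: e; set k := #|covered|; set a := #|F|; nia.
Qed.
End GraphLines.

(** * Coordinates in the projective plane *)

Section Plane.
Variable F : finFieldType.
Local Notation V3 := 'rV[F]_3.
Implicit Types (P Q X : point F) (l m : {set point F}).

Lemma dim_le3 (U : {vspace V3}) : (\dim U <= 3)%N.
Proof. by apply: leq_trans (dimvS (subvf U)) _; rewrite dimvf. Qed.

Lemma pointP P : exists2 v : V3, v != 0 & val P = <[v]>%VS.
Proof.
have dP := valP P; exists (vpick (val P)).
  by rewrite vpick0 -dimv_eq0 (eqP dP).
by apply/eqP; rewrite eq_sym eqEdim -memvE memv_pick dim_vline vpick0 -dimv_eq0 (eqP dP).
Qed.

Lemma vline_cap0 (U : {vspace V3}) e : e \notin U -> (<[e]> :&: U)%VS = 0%VS.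
Proof.
move=> eU; apply/eqP; rewrite -subv0; apply/subvP => u /memv_capP[/vlineP[k ->] ku].
have [->|k0] := eqVneq k 0; first by rewrite scale0r mem0v.
by case/negP: eU; rewrite -[e](scalerK k0) memvZ.
Qed.

Lemma span2 (W : {vspace V3}) (e1 e2 : V3) : \dim W = 2 -> e1 \in W -> e2 \in W ->
  e2 != 0 -> e1 \notin <[e2]>%VS -> W = (<[e1]> + <[e2]>)%VS.
Proof.
move=> dW w1 w2 n2 n1.
have n0 : e1 != 0 by apply: contraNneq n1 => ->; rewrite mem0v.
apply/esym/eqP; rewrite eqEdim subv_add -!memvE w1 w2 dW /=.
by have := dimv_sum_cap <[e1]> <[e2]>; rewrite vline_cap0 // dimv0 addn0 !dim_vline n0 n2 => ->.
Qed.

Lemma lineP l : l \in lines F -> exists2 W, \dim W = 2 & l = line_of W.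
Proof. by case/imsetP => W; rewrite inE => /eqP; exists W. Qed.

Lemma line_meet l m P Q : l \in lines F -> m \in lines F -> l != m ->
  P \in l -> P \in m -> Q \in l -> Q \in m -> P = Q.
Proof.
move=> /lineP[U dU ->] /lineP[W dW ->] UW.
have [[u u0 Pu] [v v0 Qv]] := (pointP P, pointP Q).
rewrite !inE Pu Qv -!memvE => uU uW vU vW.
apply: val_inj; rewrite Pu Qv; apply/eqP; rewrite eqEdim !dim_vline u0 v0 andbT -memvE.
apply: contraNT UW => n; apply/eqP; congr line_of.
by rewrite (span2 dU uU vU v0 n) (span2 dW uW vW v0 n).
Qed.

(** All that the affine computations need to know about the lines lP P. *)
Record chart l (lP : point F -> {set point F}) B (f : F -> F)
    (pt : F * F -> point F) (dir : F -> point F) : Prop := Chart {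
  chart_inj : injective pt;
  chart_dir_inj : injective dir;
  chart_affine : forall X, X \notin l <-> exists p, X = pt p;
  chart_dir : forall P, P \in l <-> P = B \/ exists x, P = dir x;
  chart_dir_neq : forall x, dir x <> B;
  chart_infty : forall p, (pt p \in lP B) = (p.1 == 0);
  chart_line : forall x p, (pt p \in lP (dir x)) = (x \in lines_at f p)
}.

(** Let B = <e2>, l = <e1, e2> and lP B = <e0, e2>, and put
pt (m, b) = <e0 + m e1 + b e2> and dir x = <e1 - x e2>. A line through dir x
other than l meets lP B in one affine point, whose ordinate is f x. *)
Lemma exists_chart l lP B : l \in lines F ->
    (forall P, P \in l -> [/\ lP P \in lines F, P \in lP P & lP P != l]) ->
  B \in l -> exists f pt dir, chart l lP B f pt dir.
Proof.
move=> /lineP[W dW lW] hlP Bl.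
have [/lineP[V dV lV] BV VW'] := hlP B Bl.
have VW : V != W by apply: contraNneq VW' => e; rewrite lV lW e.
have [e2 n2 Be] := pointP B.
have e2W : e2 \in W by move: Bl; rewrite lW inE Be -memvE.
have e2V : e2 \in V by move: BV; rewrite lV inE Be -memvE.
have [e1 e1W e12] : exists2 e1, e1 \in W & e1 \notin <[e2]>%VS.
  have /subvPn[e] : ~~ (W <= <[e2]>)%VS.
    by apply/negP => /dimvS; rewrite dW dim_vline n2.
  by exists e.
have [e0 e0V e0W] : exists2 e0, e0 \in V & e0 \notin W.
  have /subvPn[e] : ~~ (V <= W)%VS.
    by apply: contra VW => VW; rewrite eqEdim VW dW dV.
  by exists e.
have inW w : w \in W -> exists b c, w = b *: e1 + c *: e2.
  rewrite (span2 dW e1W e2W n2 e12) => /memv_addP[_ /vlineP[b ->] [_ /vlineP[c ->] ->]].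
  by exists b, c.
have e02 : e0 \notin <[e2]>%VS.
  by apply: contra e0W => /vlineP[k ->]; rewrite memvZ.
have e1V : e1 \notin V.
  apply: contra e0W => e1V; rewrite (span2 dW e1W e2W n2 e12).
  by rewrite -(span2 dV e1V e2V n2 e12).
have inV v : v \in V -> exists a c, v = a *: e0 + c *: e2.
  rewrite (span2 dV e0V e2V n2 e02) => /memv_addP[_ /vlineP[b ->] [_ /vlineP[c ->] ->]].
  by exists b, c.
have full v : exists a, exists2 w, w \in W & v = a *: e0 + w.
  have : v \in (<[e0]> + W)%VS.
    suff -> : (<[e0]> + W)%VS = fullv by rewrite memvf.
    apply/eqP; rewrite eqEdim subvf dimvf /=.
    have := dimv_sum_cap <[e0]> W; rewrite vline_cap0 // dimv0 addn0 dim_vline dW => ->.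
    by have -> : e0 != 0 by apply: contraNneq e0W => ->; rewrite mem0v.
  by case/memv_addP=> _ /vlineP[a ->] [w wW ->]; exists a, w.
pose vec (p : F * F) : V3 := e0 + (p.1 *: e1 + p.2 *: e2).
pose dvec (x : F) : V3 := e1 - x *: e2.
pose mk v : point F := insubd B <[v]>%VS.
have mkE v : v != 0 -> val (mk v) = <[v]>%VS.
  by move=> v0; rewrite val_insubd /= dim_vline v0.
have vecW p : vec p \notin W.
  by rewrite /vec rpredDr // rpredD // rpredZ.
have vec0 p : vec p != 0 by apply: contraNneq (vecW p) => ->; rewrite mem0v.
have dvec2 x : dvec x \notin <[e2]>%VS.
  by rewrite /dvec rpredBr // memvZ // memv_line.
have dvec0 x : dvec x != 0 by apply: contraNneq (dvec2 x) => ->; rewrite mem0v.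
have dvecW x : dvec x \in W by rewrite /dvec rpredB // rpredZ.
have lin a k j : a *: e0 + (k *: e1 + j *: e2) = 0 -> [/\ a = 0, k = 0 & j = 0].
  have [-> |a0 /eqP] := eqVneq a 0; last first.
    rewrite addr_eq0 => /eqP e; case/negP: e0W.
    by rewrite -[e0](scalerK a0) e memvZ // rpredN rpredD // memvZ.
  have [-> |k0 /eqP] := eqVneq k 0.
    by rewrite !scale0r !add0r => /eqP; rewrite scaler_eq0 (negPf n2) orbF => /eqP->.
  rewrite scale0r add0r addr_eq0 => /eqP e; case/negP: e12.
  by rewrite -[e1](scalerK k0) e -scaleNr !memvZ // memv_line.
have mkdW x : mk (dvec x) \in l by rewrite lW inE mkE // -memvE.
exists (fun x => odflt 0 [pick y | mk (vec (0, y)) \in lP (mk (dvec x))]).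
exists (mk \o vec), (mk \o dvec); split => /=.
- move=> p p' /(congr1 val); rewrite /= !mkE // => e.
  have /vlineP[k ek] : vec p' \in <[vec p]>%VS by rewrite e memv_line.
  have [k1 p1 p2] : [/\ 1 - k = 0, p'.1 - k * p.1 = 0 & p'.2 - k * p.2 = 0].
    apply: lin; rewrite -[RHS](subrr (vec p')) {2}ek.
    by apply/rowP => i; rewrite !mxE; ring.
  move: p1 p2; rewrite -(subr0_eq k1) !mul1r => /subr0_eq + /subr0_eq.
  by case: p p' {e ek} => [? ?] [? ?] /= -> ->.
- move=> x x' /(congr1 val); rewrite /= !mkE // => e.
  have /vlineP[k ek] : dvec x' \in <[dvec x]>%VS by rewrite e memv_line.
  have [_ k1 xk] : [/\ 0 = 0 :> F, 1 - k = 0 & k * x - x' = 0].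
    apply: lin; rewrite -[RHS](subrr (dvec x')) {2}ek.
    by apply/rowP => i; rewrite !mxE; ring.
  by move: xk; rewrite -(subr0_eq k1) mul1r => /subr0_eq.
- move=> X; split=> [|[p ->]]; last by rewrite lW inE mkE // -memvE.
  have [v v0 Xv] := pointP X; rewrite lW inE Xv -memvE => vW.
  have [a [w wW vE]] := full v; have [b [c wE]] := inW w wW.
  have a0 : a != 0 by apply: contraNneq vW => a0; rewrite vE a0 scale0r add0r.
  exists (a^-1 * b, a^-1 * c); apply: val_inj; rewrite /= mkE // Xv.
  apply/eqP; rewrite eqEdim !dim_vline v0 vec0 andbT -memvE; apply/vlineP; exists a.
  by rewrite vE wE /vec; apply/rowP => i; rewrite !mxE /=; field.
- move=> P; split=> [Pl|[->//|[x ->]//]].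
  have [w w0 Pw] := pointP P; move: Pl; rewrite lW inE Pw -memvE => wW.
  have [b [c wE]] := inW w wW; have [b0|b0] := eqVneq b 0.
    left; apply: val_inj; rewrite Pw Be; apply/eqP; rewrite eqEdim !dim_vline w0 n2 andbT.
    by rewrite -memvE wE b0 scale0r add0r memvZ // memv_line.
  right; exists (- c / b); apply: val_inj; rewrite /= mkE // Pw.
  apply/eqP; rewrite eqEdim !dim_vline w0 dvec0 andbT -memvE; apply/vlineP; exists b.
  by rewrite wE /dvec; apply/rowP => i; rewrite !mxE /=; field.
- move=> x e; case/negP: (dvec2 x).
  by rewrite memvE -mkE // e Be.
- move=> p; rewrite lV inE mkE // -memvE /vec rpredDl //.
  rewrite rpredDr; last by rewrite memvZ.
  apply/idP/eqP => [|->]; last by rewrite scale0r mem0v.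
  by move=> h; apply/eqP; apply: contraNT e1V => p0; rewrite -[e1](scalerK p0) memvZ.
move=> x p; have [/lineP[U dU lU] dU1 UW'] := hlP _ (mkdW x).
have {}dU1 : dvec x \in U by move: dU1; rewrite lU inE mkE // -memvE.
have e2U : e2 \notin U.
  apply: contraNN UW' => e2U; rewrite lU lW; apply/eqP; congr line_of.
  by rewrite (span2 dU dU1 e2U n2 (dvec2 x)) (span2 dW (dvecW x) e2W n2 (dvec2 x)).
have memU r : (mk (vec r) \in lP (mk (dvec x))) = (vec r \in U).
  by rewrite lU inE mkE // -memvE.
have [y yU] : exists y, vec (0, y) \in U.
  have [v v0 /memv_capP[vU vV]] : exists2 v, v != 0 & v \in (U :&: V)%VS.
    exists (vpick (U :&: V)); last exact: memv_pick.
    rewrite vpick0 -dimv_eq0; have := dimv_sum_cap U V; rewrite dU dV.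
    move: (dim_le3 (U + V)); case: (\dim (U :&: V)) => // h e.
    by rewrite addn0 in e; rewrite e in h.
  have [a [c vE]] := inV v vV.
  have a0 : a != 0.
    apply: contraNneq e2U => a0; move: vE; rewrite a0 scale0r add0r => vE.
    have c0 : c != 0 by apply: contraNneq v0 => c0; rewrite vE c0 scale0r.
    by rewrite -[e2](scalerK c0) -vE memvZ.
  exists (a^-1 * c); suff -> : vec (0, a^-1 * c) = a^-1 *: v by rewrite memvZ.
  by rewrite vE /vec; apply/rowP => i; rewrite !mxE /=; field.
(* The vector of r differs from a vector of U by a multiple of e2. *)
have memE r z : vec (0, z) \in U -> (vec r \in U) = (z == x * r.1 + r.2).
  move=> zU; have -> : vec r = vec (0, z) + r.1 *: dvec x + (x * r.1 + r.2 - z) *: e2.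
    by rewrite /vec /dvec; apply/rowP => i; rewrite !mxE /=; ring.
  rewrite rpredDl; last by rewrite rpredD // memvZ.
  rewrite [RHS]eq_sym -[RHS]subr_eq0; apply/idP/eqP => [|->]; last by rewrite scale0r mem0v.
  by move=> h; apply/eqP; apply: contraNT e2U => p0; rewrite -[e2](scalerK p0) memvZ.
rewrite memU inE; case: pickP => [z|/(_ y)]; rewrite memU; last by rewrite yU.
exact: memE.
Qed.
End Plane.

(** * Kakeya sets and dual ovals *)

Section Kakeya.
Variable F : finFieldType.
Variables (l : {set point F}) (lP : point F -> {set point F}).
Hypothesis l_line : l \in lines F.
Hypothesis lP_line : forall P, P \in l -> [/\ lP P \in lines F, P \in lP P & lP P != l].

Lemma meet_base P Q : P \in l -> Q \in l -> Q \in lP P -> Q = P.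
Proof.
move=> Pl Ql QP; have [PL PP Pn] := lP_line Pl.
by apply: (line_meet PL l_line Pn).
Qed.

Lemma lP_inj : {in l &, injective lP}.
Proof.
move=> P Q Pl Ql e; apply/esym/meet_base => //; rewrite e.
by have [] := lP_line Ql.
Qed.

Definition through X : {set point F} := [set Q in l | X \in lP Q].
Definition even_kakeya Q := [forall X, (X \in lP Q :\: l) ==> ~~ odd #|through X|].

Section Chart.
Variables (B : point F) (f : F -> F) (pt : F * F -> point F) (dir : F -> point F).
Hypothesis ch : chart l lP B f pt dir.

Lemma chart_base : l = B |: [set dir x | x : F].
Proof.
apply/setP => P; rewrite !inE; apply/idP/orP => [/(chart_dir ch)[->|[x ->]]|h].
- by left.
- by right; apply: imset_f.
by apply/(chart_dir ch); case: h => [/eqP|/imsetP[x _]] ->; [left|right; exists x].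
Qed.

Lemma dir_base x : dir x \in l.
Proof. by rewrite chart_base inE imset_f ?orbT. Qed.

Lemma inf_base : B \in l.
Proof. by rewrite chart_base inE set11. Qed.

Lemma inf_notin_dir (S : {pred F}) : B \notin [set dir x | x in S].
Proof. by apply/imsetP => -[x _ /esym/(chart_dir_neq ch)]. Qed.

Lemma pt_base p : pt p \notin l.
Proof. by apply/(chart_affine ch); exists p. Qed.

Lemma card_base : #|l| = #|F|.+1.
Proof. by rewrite chart_base cardsU1 inf_notin_dir card_imset //; apply: chart_dir_inj ch. Qed.

Lemma card_through p : #|through (pt p)| = mult f p.
Proof.
rewrite (cardsD1 B) inE inf_base (chart_infty ch) addnC /mult; congr addn.
rewrite -(card_imset _ (chart_dir_inj ch)); apply: eq_card => Q.
rewrite !inE; apply/and3P/imsetP => [[QB Ql Qp]|[x xp ->]].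
  move/(chart_dir ch): Ql Qp => [/eqP|[x ->]]; first by rewrite (negPf QB).
  by rewrite (chart_line ch); exists x.
split; [by apply/eqP => /(chart_dir_neq ch) | exact: dir_base | by rewrite (chart_line ch)].
Qed.

Lemma card_kakeya : #|(\bigcup_(P in l) lP P) :\: l| = #|covered f|.
Proof.
rewrite -(card_imset _ (chart_inj ch)); apply: eq_card => X.
rewrite inE; apply/andP/imsetP => [[Xl /bigcupP[P Pl XP]]|[p + ->]].
  have [p Xp] := (chart_affine ch X).1 Xl; exists p => //.
  by rewrite inE -card_through; apply/card_gt0P; exists P; rewrite inE Pl -Xp.
rewrite inE -card_through => /card_gt0P[P]; rewrite inE => /andP[Pl pP].
by split; [apply: pt_base | apply/bigcupP; exists P].
Qed.

Lemma even_kakeya_infty : even_kakeya B -> even_infty f.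
Proof.
move=> /forallP n; apply/forallP => b; have := n (pt (0, b)).
by rewrite card_through inE pt_base (chart_infty ch) eqxx.
Qed.

Lemma even_kakeya_dir x : even_line f x -> even_kakeya (dir x).
Proof.
move=> /forallP cl; apply/forallP => X; apply/implyP; rewrite inE => /andP[Xl].
have [p ->] := (chart_affine ch X).1 Xl.
by rewrite (chart_line ch) card_through pt_on_lines_at => /eqP <-.
Qed.
End Chart.

(** The base point of the chart is one whose line has no odd point, if there is
any; this is how the two cases of [card_covered_ge] are brought together. *)
Lemma kakeya_chart : exists B f pt dir,
  chart l lP B f pt dir /\ (forall x, even_line f x -> even_infty f).
Proof.
have [B [Bl nB]] : exists B, B \in l /\ forall Q, Q \in l -> even_kakeya Q -> even_kakeya B.
  have [Q /andP[Ql nQ]|none] := pickP (fun Q => (Q \in l) && even_kakeya Q).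
    by exists Q.
  have [P Pl] : exists P, P \in l.
    have [W dW ->] := lineP l_line.
    have W0 : vpick W != 0 by rewrite vpick0 -dimv_eq0 dW.
    have dv : \dim <[vpick W]> == 1%N by rewrite dim_vline W0.
    by exists (Sub <[vpick W]>%VS dv); rewrite inE /= -memvE memv_pick.
  by exists P; split=> // Q Ql nQ; have := none Q; rewrite Ql nQ.
have [f [pt [dir ch]]] := exists_chart l_line lP_line Bl.
exists B, f, pt, dir; split=> // x /(even_kakeya_dir ch) nx.
exact: even_kakeya_infty ch (nB _ (dir_base ch x) nx).
Qed.

Section Oval.
Variable C : point F.
Hypothesis Cl : C \in l.
Let O := l |: [set lP Q | Q in l :\ C].

Lemma oval_of_kakeyaP X m : m \in O -> X \in m -> m != l -> X \in l -> m = lP X /\ X != C.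
Proof.
rewrite !inE => /orP[/eqP->|/imsetP[Q]]; first by rewrite eqxx.
by rewrite !inE => /andP[QC Ql] -> XQ _ Xl; rewrite (meet_base Ql Xl XQ).
Qed.

(** Three concurrent lines meet off l, since through a point of l there passes
only one line other than l. *)
Lemma oval_of_kakeya_dual :
    #|l| = #|F|.+1 ->
    (forall X Q1 Q2 Q3, X \notin l -> uniq [:: C; Q1; Q2; Q3] ->
       {subset [:: Q1; Q2; Q3] <= through X} -> False) ->
  dual_oval O.
Proof.
move=> cl no3; split.
- apply/subsetP => m; rewrite !inE => /orP[/eqP->//|/imsetP[Q]].
  by rewrite !inE => /andP[_ /lP_line[]] ? _ _ ->.
- rewrite cardsU1 card_in_imset => [|P Q]; last first.
    by rewrite !inE => /andP[_ Pl] /andP[_ Ql]; apply: lP_inj.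
  rewrite (_ : l \notin _); last first.
    by apply/imsetP => -[Q]; rewrite !inE => /andP[_ /lP_line[_ _ /eqP n]] /esym.
  by rewrite -cl (cardsD1 C l) Cl.
move=> l1 l2 l3 O1 O2 O3 n12 n13 n23 [X [X1 X2 X3]].
have [Xl|Xl] := boolP (X \in l).
  have two m m' : m \in O -> m' \in O -> X \in m -> X \in m' -> m != m' -> m != l -> m' = l.
    move=> Om Om' Xm Xm' mm' ml; apply/eqP; apply: contraNT mm' => m'l.
    by have [-> _] := oval_of_kakeyaP Om Xm ml Xl; have [-> _] := oval_of_kakeyaP Om' Xm' m'l Xl.
  have [e1|n1] := eqVneq l1 l; last first.
    by move/eqP: n23; rewrite (two l1 l2) // (two l1 l3).
  have n2 : l2 != l by rewrite -e1 eq_sym.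
  by move/eqP: n13; rewrite e1 (two l2 l3).
have pre m : m \in O -> X \in m -> exists2 Q, m = lP Q & (Q \in through X) && (Q != C).
  rewrite !inE => /orP[/eqP->|/imsetP[Q]]; first by rewrite (negPf Xl).
  by rewrite !inE => /andP[QC Ql] -> XQ; exists Q; rewrite // inE Ql XQ QC.
have [Q1 E1 /andP[t1 c1]] := pre _ O1 X1.
have [Q2 E2 /andP[t2 c2]] := pre _ O2 X2.
have [Q3 E3 /andP[t3 c3]] := pre _ O3 X3.
apply: (no3 X Q1 Q2 Q3 Xl) => [|Q].
  have q12 : Q1 != Q2 by apply: contraNneq n12 => e; rewrite E1 E2 e.
  have q13 : Q1 != Q3 by apply: contraNneq n13 => e; rewrite E1 E3 e.
  have q23 : Q2 != Q3 by apply: contraNneq n23 => e; rewrite E2 E3 e.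
  exact: uniq4.
by rewrite mem_seq3 => /or3P[]/eqP->.
Qed.

Lemma oval_of_kakeya_exceptional : exceptional_points O l = [set C].
Proof.
apply/setP => P; rewrite !inE; apply/andP/eqP => [[Pl /forall_inP h]|->].
  apply/eqP; apply: contraT => PC; have [_ PP] := lP_line Pl.
  have /h : lP P \in O by rewrite !inE imset_f ?orbT // !inE PC.
  by rewrite PP => /= ->.
split=> //; apply/forall_inP => m mO; apply/implyP => Cm; apply: contraT => ml.
by have [_] := oval_of_kakeyaP mO Cm ml Cl; rewrite eqxx.
Qed.

Lemma oval_of_kakeya_line P : P \in l -> oval_line O l (lP C) P = lP P.
Proof.
move=> Pl; rewrite /oval_line; case: pickP => [m /and3P[mO ml Pm]|none] /=.
  by have [] := oval_of_kakeyaP mO Pm ml Pl.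
have [->//|PC] := eqVneq P C; have [_ PP PL] := lP_line Pl.
by have := none (lP P); rewrite PP PL !inE imset_f ?orbT // !inE PC.
Qed.
End Oval.
End Kakeya.

Section Extremum.
Variable F : finFieldType.
Hypothesis oddq : odd #|F|.
Local Notation q := #|F|.
Local Notation kmin := ((q * (q + 1)) %/ 2 + (q - 1) %/ 2)%N.

(** In the case of equality C is the point of l whose line carries all triple
points: three concurrent lines among the others would, with the line of C, give
a point of multiplicity 4. *)
Lemma kakeya_bound (K : {set point F}) : kakeya K ->
  (kmin <= #|K|)%N /\
  (#|K| = kmin -> exists (O : {set {set point F}}) (l lA : {set point F}) (A : point F),
     [/\ dual_oval O, l \in O, exceptional_points O l = [set A],
         [/\ lA \in lines F, lA != l & A \in lA] & K = oval_kakeya O l lA]).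
Proof.
case=> l ll [lP lPl ->].
have [B [f [pt [dir [ch ncl]]]]] := kakeya_chart ll lPl.
have [lb eq] := card_covered_ge oddq ncl.
rewrite (card_kakeya ch); split=> // /eq[le3 [c cP]].
have Cl := dir_base ch c; set C := dir c in Cl.
exists (l |: [set lP Q | Q in l :\ C]), l, (lP C), C; split.
- apply: (oval_of_kakeya_dual ll lPl Cl (card_base ch)) => X Q1 Q2 Q3 Xl.
  have [p ->] := (chart_affine ch X).1 Xl; rewrite cons_uniq => /andP[nC uQ] sub.
  have ge3 : (3 <= #|through l lP (pt p)|)%N.
    by rewrite cardE (uniq_leq_size uQ) // => Q /sub; rewrite mem_enum.
  have m3 : mult f p = 3.
    by apply/eqP; rewrite eqn_leq le3 -(card_through ch) ge3.
  have sub4 : {subset [:: C; Q1; Q2; Q3] <= through l lP (pt p)}.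
    move=> Q; rewrite in_cons => /orP[/eqP->|/sub//].
    by rewrite inE Cl (chart_line ch) cP.
  have : (4 <= #|through l lP (pt p)|)%N.
    rewrite cardE (uniq_leq_size (s1 := [:: C; Q1; Q2; Q3])) //= ?nC //.
    by move=> Q /sub4; rewrite mem_enum.
  by rewrite (card_through ch) m3.
- by rewrite !inE eqxx.
- exact: oval_of_kakeya_exceptional.
- by have [] := lPl C Cl.
rewrite /oval_kakeya; congr (_ :\: _); apply: eq_bigr => P Pl.
by rewrite oval_of_kakeya_line.
Qed.

(** The exceptional point A serves as base point of the chart, so that m = 0 is lA
and the lines x belong to O. *)
Lemma card_oval_kakeya (O : {set {set point F}}) (l lA : {set point F}) (A : point F) :
  dual_oval O -> l \in O -> exceptional_points O l = [set A] ->
  lA \in lines F -> lA != l -> A \in lA -> #|oval_kakeya O l lA| = kmin.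
Proof.
move=> [subO _ noc] lO exc lAl lAn AlA; pose lP := oval_line O l lA.
have ll := subsetP subO _ lO.
have Al : A \in l by have := set11 A; rewrite -exc inE => /andP[].
have lPO P : P \in l -> P != A -> [/\ lP P \in O, P \in lP P & lP P != l].
  rewrite /lP /oval_line => Pl PA; case: pickP => [m /and3P[mO ml Pm]|none] //=.
  case/negP: PA; rewrite -in_set1 -exc inE Pl; apply/forall_inP => m mO.
  by apply/implyP => Pm; apply: contraFT (none m) => ml; rewrite mO ml Pm.
have lPl P : P \in l -> [/\ lP P \in lines F, P \in lP P & lP P != l].
  move=> Pl; have [PA|PA] := eqVneq P A; last first.
    by have [PO PP Pn] := lPO P Pl PA; split=> //; apply: (subsetP subO).
  rewrite PA /lP /oval_line; case: pickP => [m /and3P[mO ml Am]|_] //=.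
  have := set11 A; rewrite -exc inE Al => /forall_inP/(_ m mO).
  by rewrite Am (negPf ml).
have [f [pt [dir ch]]] := exists_chart ll lPl Al.
rewrite /oval_kakeya (card_kakeya ch); apply: card_covered_le2 => // p.
rewrite leqNgt; apply/negP => /card_gt2P[x [y [z [[xp yp zp] [xy yz zx]]]]].
have dO u : lP (dir u) \in O.
  by have [] := lPO (dir u) (dir_base ch u); first exact/eqP/(chart_dir_neq ch).
have dn u v : u != v -> lP (dir u) != lP (dir v).
  apply: contraNneq => /(lP_inj ll lPl (dir_base ch u) (dir_base ch v)).
  by move/(chart_dir_inj ch)->.
apply: (noc _ _ _ (dO x) (dO y) (dO z)); rewrite ?dn // 1?eq_sym //.
by exists (pt p); rewrite !(chart_line ch).
Qed.
End Extremum.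

Local Close Scope ring_scope.

Theorem proposition7 (q : nat) (F : finFieldType) (hF : #|F| = q) (hq : odd q)
    (K : {set point F}) (hK : kakeya K) :
  (q * (q + 1)) %/ 2 + (q - 1) %/ 2 <= #|K| /\
  (#|K| = (q * (q + 1)) %/ 2 + (q - 1) %/ 2 <->
   exists (O : {set {set point F}}) (l lA : {set point F}) (A : point F),
     [/\ dual_oval O, l \in O, exceptional_points O l = [set A],
         [/\ lA \in lines F, lA != l & A \in lA] & K = oval_kakeya O l lA]).
Proof.
subst q; have [le eq] := kakeya_bound hq hK; split=> //; split=> //.
by case=> O [l [lA [A [dO lO exc [lAl lAn AlA] ->]]]]; apply: card_oval_kakeya exc lAl lAn AlA.
Qed.
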